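(* Let $X$ be a nonempty set, $\Sigma\subseteq 2^X$ a $\sigma$-algebra on $X$, $\mathcal E\subseteq\Sigma$ a nonempty collection of sets, $\mathcal E^0:=\mathcal E\setminus\{\emptyset\}$, and let $\mathbf G=\{G_E:E\in\mathcal E^0\}$ be an FCA. The following assertions are equivalent. (i) $\mathbf G$ is trace-generated by a nondecreasing functional $\Phi\colon\mathbf F\to[0,\infty]$ satisfying $\Phi(0_X)=0$, i.e. $G_E(u)=\Phi(Z_{E,X}u)$ for all $E\in\mathcal E^0$, $u\in\mathbf F_E$. (ii) $\mathbf G$ is globally order compatible, i.e. for all $E,F\in\mathcal E^0$, $u\in\mathbf F_E$, $v\in\mathbf F_F$: if $Z_{E,X}u\le Z_{F,X}v$ pointwise on $X$, then $G_E(u)\le G_F(v)$. (iii) The rule $\varphi(Z_{E,X}u):=G_E(u)$ ($E\in\mathcal E^0$, $u\in\mathbf F_E$) defines a well-defined nondecreasing functional $\varphi\colon\mathscr T_{\mathcal E}\to[0,\infty]$. If these conditions hold, define for each $f\in\mathbf F$ $$\underline\Phi(f):=\sup\{\varphi(h):h\in\mathscr T_{\mathcal E},\ h\le f\},\qquad \overline\Phi(f):=\inf\{\varphi(h):h\in\mathscr T_{\mathcal E},\ f\le h\},$$ with the convention $\inf\emptyset:=\infty$. Then $\underline\Phi$ and $\overline\Phi$ are respectively the least and the greatest nondecreasing trace generators of $\mathbf G$. In particular, every nondecreasing trace generator $\Phi$ of $\mathbf G$ satisfies $\underline\Phi(f)\le\Phi(f)\le\overline\Phi(f)$ for all $f\in\mathbf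 F$, and the global (nondecreasing trace) generator is unique if and only if $\underline\Phi=\overline\Phi$.
   Context: $\mathbf F$ is the class of all nonnegative bounded $\Sigma$-measurable functions on $X$, ordered pointwise. For $E\in\mathcal E^0$, $\Sigma_E=\{B\cap E:B\in\Sigma\}$ and $\mathbf F_E$ is the class of all nonnegative bounded $\Sigma_E$-measurable functions on $E$, ordered pointwise. $0_E$ and $0_X$ are the zero functions on $E$ and on $X$. An FCA (family of conditional aggregation operators) over $\mathcal E$ is represented by a family $\mathbf G=\{G_E:E\in\mathcal E^0\}$ of functionals $G_E\colon\mathbf F_E\to[0,\infty]$, each nondecreasing for the pointwise order and satisfying $G_E(0_E)=0$. Zero extension: for $E\in\mathcal E^0$ and $u\in\mathbf F_E$, $Z_{E,X}u\in\mathbf F$ is the function equal to $u$ on $E$ and to $0$ on $X\setminus E$. Trace domain: $\mathscr T_{\mathcal E}:=\bigcup_{E\in\mathcal E^0}Z_{E,X}(\mathbf F_E)\subseteq\mathbf F$, with the pointwise order inherited from $\mathbf F$. A nondecreasing trace generator of $\mathbf G$ is a nondecreasing functional $\Phi\colon\mathbf F\to[0,\infty]$ with $\Phi(0_X)=0$ and $G_E(u)=\Phi(Z_{E,X}u)$ for all $E\in\mathcal E^0$ and $u\in\mathbf F_E$. ''Least'' and ''greatest'' refer to the pointwise order of functionals on $\mathbf F$.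
   Formalization: That the upper functional is the greatest nondecreasing trace generator is claimed only when 𝓔⁰ is nonempty; for 𝓔={∅} it equals inf ∅=∞ at 0_X, so the original claim fails there. *)

(* Defs.v *)
From HB Require Import structures.
From mathcomp Require Import all_boot all_order all_algebra.
From mathcomp Require Import all_classical all_reals all_analysis.
Set Implicit Arguments. Unset Strict Implicit. Unset Printing Implicit Defensive.
Import Order.TTheory GRing.Theory Num.Theory.
Import numFieldNormedType.Exports.
Local Open Scope classical_set_scope.
Local Open Scope ring_scope.

(* The measurable space (X, Sigma) is a [measurableType], whose sigma-algebra
   is [measurable]; such a type is pointed, hence nonempty. *)

Definition bF (R : realType) (d : measure_display) (X : measurableType d)
    : set (X -> R) :=
  [set f : X -> R | [/\ measurable_fun [set: X] f, forall x, 0 <= f x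
                      & [bounded f x | x in [set: X]]]].
Arguments bF R {d} X.

(* The domain of a function in F_E is the subtype of the points of E.  The
   preimage of a Borel set is a set in this subtype; its image in X must lie
   in Sigma_E = [strace measurable E]. *)
Definition bFE (R : realType) (d : measure_display) {X : measurableType d}
    (E : set X) : set (E -> R) :=
  [set u : E -> R | [/\ forall B : set R, measurable B ->
                          strace measurable E (set_val @` (u @^-1` B)),
                        forall x, 0 <= u x
                      & [bounded u x | x in [set: E]]]].
Arguments bFE R {d X} E.

Definition nonempty_sets {X : Type} (calE : set (set X)) : set (set X) :=
  calE `\ set0.

Definition zero_ext {R : realType} {X : Type} {E : set X} (u : E -> R) : X -> R :=
  'valL_ 0 u.

Lemma zero_ext_in {R : realType} {X : Type} (E : set X) (u : E -> R) (x : E) :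
  zero_ext u (set_val x) = u x.
Proof. exact: (congr1 (fun f : E -> R => f x) (valLK 0 u)). Qed.

Lemma zero_ext_out {R : realType} {X : Type} (E : set X) (u : E -> R) (x : X) :
  ~ E x -> zero_ext u x = 0.
Proof. by move=> nEx; rewrite /zero_ext /= oinv_set_val insubF ?memNset. Qed.

Lemma zero_ext_bF (R : realType) (d : measure_display) {X : measurableType d}
    (E : set X) (u : E -> R) :
  measurable E -> bFE R E u -> bF R X (zero_ext u).
Proof.
move=> mE [mu u0 [M [Mr uM]]].
have H (P : R -> Prop) : P 0 -> (forall x, P (u x)) -> forall x, P (zero_ext u x).
  move=> P0 Pu x; have [Ex|nEx] := pselect (E x); last by rewrite zero_ext_out.
  by rewrite -[x]/(set_val (SigSub (mem_set Ex) : E)) zero_ext_in.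
split.
- move=> _ B mB; rewrite setTI.
  have -> : zero_ext u @^-1` B =
      set_val @` (u @^-1` B) `|` (~` E `&` [set _ | B 0]).
    apply/seteqP; split => [x /= Bx|x /= [[y By <-]|[nEx B0]]].
    + have [Ex|nEx] := pselect (E x); last first.
        by right; split => //; rewrite -(zero_ext_out u nEx).
      left; exists (SigSub (mem_set Ex) : E) => //=.
      by rewrite -zero_ext_in.
    + by rewrite zero_ext_in.
    + by rewrite zero_ext_out.
  apply: measurableU.
    by have [A mA <-] := mu B mB; exact: measurableI.
  have [B0|nB0] := pselect (B 0).
    rewrite (_ : [set _ | _] = setT) ?setIT; first exact: measurableC.
    by apply/seteqP; split.
  rewrite (_ : [set _ | _] = set0) ?setI0; first exact: measurable0.
  by apply/seteqP; split.
- exact: (H (fun y => 0 <= y)).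
- exists (Num.max M 0); split; first exact: num_real.
  move=> N; rewrite gt_max => /andP[MN N0] x _ /=.
  apply: (H (fun y => `|y| <= N)); first by rewrite normr0 ltW.
  by move=> y; exact: (uM N MN y).
Qed.

Lemma zero_bFE (R : realType) (d : measure_display) {X : measurableType d}
    (E : set X) : bFE R E (fun=> 0).
Proof.
split => // [B _|]; last first.
  by exists 0; split => // M M0 x _ /=; rewrite normr0 ltW.
have [B0|nB0] := pselect (B 0).
  exists setT; first exact: measurableT.
  apply/seteqP; split => [x [_ Ex]|x [y _ <-]].
    by exists (SigSub (mem_set Ex) : E).
  by split => //; exact: set_valP.
exists set0; first exact: measurable0.
by rewrite set0I; apply/seteqP; split => // x [].
Qed.

Lemma zero_bF (R : realType) (d : measure_display) (X : measurableType d) :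
  bF R X (fun=> 0).
Proof.
split => //; by exists 0; split => // M M0 x _ /=; rewrite normr0 ltW.
Qed.

Definition zeroFE (R : realType) (d : measure_display) {X : measurableType d}
  (E : set X) : bFE R E := SigSub (mem_set (@zero_bFE R d X E)).
Arguments zeroFE R {d X} E.

Definition zeroF (R : realType) (d : measure_display) (X : measurableType d)
  : bF R X := SigSub (mem_set (@zero_bF R d X)).
Arguments zeroF R {d} X.

(* A functional on a class A of real functions takes its values in \bar R; the
   codomain [0, +oo] is expressed by [nonneg_functional]. *)
Definition nonneg_functional {R : realType} {T : Type} {A : set (T -> R)}
    (Phi : A -> \bar R) : Prop :=
  forall f, (0 <= Phi f)%E.

Definition nondecreasing_functional {R : realType} {T : Type} {A : set (T -> R)}
    (Phi : A -> \bar R) : Prop :=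
  forall f g : A, (forall x, val f x <= val g x) -> (Phi f <= Phi g)%E.

Definition functional_family (R : realType) (d : measure_display)
    {X : measurableType d} (calE : set (set X)) : Type :=
  forall E : nonempty_sets calE, bFE R (val E) -> \bar R.
Arguments functional_family R {d X} calE.

Definition FCA {R : realType} {d : measure_display} {X : measurableType d}
    {calE : set (set X)} (G : functional_family R calE) : Prop :=
  forall E : nonempty_sets calE,
    [/\ nonneg_functional (G E), nondecreasing_functional (G E)
      & G E (zeroFE R (val E)) = 0%E].

Definition trace_domain (R : realType) (d : measure_display)
    {X : measurableType d} (calE : set (set X)) : set (X -> R) :=
  \bigcup_(E in nonempty_sets calE) (@zero_ext R X E @` bFE R E).
Arguments trace_domain R {d X} calE.

Lemma nonempty_sets_measurable {d : measure_display} {X : measurableType d}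
    (calE : set (set X)) (hE : calE `<=` measurable) (E : nonempty_sets calE) :
  measurable (val E).
Proof. by have [/hE] := set_valP E. Qed.

Definition Zext {R : realType} {d : measure_display} {X : measurableType d}
    {calE : set (set X)} (hE : calE `<=` measurable)
    (E : nonempty_sets calE) (u : bFE R (val E)) : bF R X :=
  SigSub (mem_set (zero_ext_bF (nonempty_sets_measurable hE E) (set_valP u))).

Lemma zero_ext_trace (R : realType) (d : measure_display) {X : measurableType d}
    {calE : set (set X)} (E : nonempty_sets calE) (u : bFE R (val E)) :
  trace_domain R calE (zero_ext (val u)).
Proof. by exists (val E); [exact: set_valP E|exists (val u) => //; exact: set_valP u]. Qed.

Definition Ztrace {R : realType} {d : measure_display} {X : measurableType d}
    {calE : set (set X)} (E : nonempty_sets calE) (u : bFE R (val E))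
    : trace_domain R calE :=
  SigSub (mem_set (zero_ext_trace u)).

Definition trace_generator {R : realType} {d : measure_display}
    {X : measurableType d} {calE : set (set X)} (hE : calE `<=` measurable)
    (G : functional_family R calE) (Phi : bF R X -> \bar R) : Prop :=
  [/\ nonneg_functional Phi, nondecreasing_functional Phi,
      Phi (zeroF R X) = 0%E
    & forall (E : nonempty_sets calE) (u : bFE R (val E)),
        G E u = Phi (Zext hE u)].

Definition globally_order_compatible {R : realType} {d : measure_display}
    {X : measurableType d} {calE : set (set X)} (G : functional_family R calE)
    : Prop :=
  forall (E F : nonempty_sets calE) (u : bFE R (val E)) (v : bFE R (val F)),
    (forall x, zero_ext (val u) x <= zero_ext (val v) x) ->
    (G E u <= G F v)%E.

(* phi is a nondecreasing functional on the trace domain obeying the rule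
   phi (Z_{E,X} u) := G_E u; the rule determines phi everywhere on its domain,
   and it is well defined exactly when such a phi exists. *)
Definition trace_rule_functional {R : realType} {d : measure_display}
    {X : measurableType d} {calE : set (set X)} (G : functional_family R calE)
    (phi : trace_domain R calE -> \bar R) : Prop :=
  [/\ nonneg_functional phi, nondecreasing_functional phi
    & forall (E : nonempty_sets calE) (u : bFE R (val E)),
        phi (Ztrace u) = G E u].

(* The supremum is taken in [0, +oo], where sup set0 = 0, whereas [ereal_sup]
   of the empty set is -oo; this is why 0 is adjoined.  It changes nothing as
   soon as the trace domain is nonempty, since 0_X is then the image of 0_E. *)
Definition lower_generator {R : realType} {d : measure_display}
    {X : measurableType d} {calE : set (set X)}
    (phi : trace_domain R calE -> \bar R) (f : bF R X) : \bar R :=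
  ereal_sup (0%E |` [set phi h | h in
    [set h : trace_domain R calE | forall x, val h x <= val f x]]).

Definition upper_generator {R : realType} {d : measure_display}
    {X : measurableType d} {calE : set (set X)}
    (phi : trace_domain R calE -> \bar R) (f : bF R X) : \bar R :=
  ereal_inf [set phi h | h in
    [set h : trace_domain R calE | forall x, val f x <= val h x]].

Definition least_functional {R : realType} {T : Type} {A : set (T -> R)}
    (P : set (A -> \bar R)) (Phi : A -> \bar R) : Prop :=
  P Phi /\ forall Psi, P Psi -> forall f, (Phi f <= Psi f)%E.

Definition greatest_functional {R : realType} {T : Type} {A : set (T -> R)}
    (P : set (A -> \bar R)) (Phi : A -> \bar R) : Prop :=
  P Phi /\ forall Psi, P Psi -> forall f, (Psi f <= Phi f)%E.

(* Main.v *)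
Require Import Defs.
From HB Require Import structures.
From mathcomp Require Import all_boot all_order all_algebra.
From mathcomp Require Import all_classical all_reals all_analysis.
Set Implicit Arguments. Unset Strict Implicit. Unset Printing Implicit Defensive.
Import Order.TTheory GRing.Theory Num.Theory.
Import numFieldNormedType.Exports.
Local Open Scope classical_set_scope.
Local Open Scope ring_scope.

(* Every h in the trace domain is some Z_{E,X} u, and any generator takes the
   value phi h = G_E u there.  Monotonicity then forces its value at f to lie
   between the values of phi at the trace functions below and above f, and the
   two extreme choices are themselves generators. *)

Section TraceGenerators.
Context {R : realType} {d : measure_display} {X : measurableType d}.
Context {calE : set (set X)} (calE_measurable : calE `<=` measurable).
Context (G : functional_family R calE).
Implicit Types (Phi : bF R X -> \bar R) (phi : trace_domain R calE -> \bar R).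

Lemma zeroFE_ext (E : set X) (x : X) : zero_ext (val (zeroFE R E)) x = 0.
Proof.
have [Ex|nEx] := pselect (E x); last by rewrite zero_ext_out.
by rewrite -[x]/(set_val (SigSub (mem_set Ex) : E)) zero_ext_in.
Qed.

Lemma ZtraceP (h : trace_domain R calE) :
  exists E (u : bFE R (val E)), h = Ztrace u.
Proof.
case: (set_valP h) => E calE_E [u uE hu].
exists (SigSub (mem_set calE_E)), (SigSub (mem_set uE)).
by apply: val_inj; rewrite /= -hu.
Qed.

Lemma trace_generator_order_compatible Phi :
  trace_generator calE_measurable G Phi -> globally_order_compatible G.
Proof. by case=> _ Phi_nd _ PhiG E F u v uv; rewrite !PhiG; exact: Phi_nd. Qed.

Lemma trace_rule_order_compatible phi :
  trace_rule_functional G phi -> globally_order_compatible G.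
Proof. by case=> _ phi_nd phiG E F u v uv; rewrite -!phiG; exact: phi_nd. Qed.

(** One trace function may be the zero extension of functions on different sets. Choosing a
    representation for each is harmless: order compatibility, applied in both directions, gives any
    two representations the same value under [G]. *)
Lemma order_compatible_trace_rule : FCA G -> globally_order_compatible G ->
  exists phi, trace_rule_functional G phi.
Proof.
move=> G_FCA Gle.
have /choice[phi phiP] : forall h : trace_domain R calE, exists y,
    exists E (u : bFE R (val E)), h = Ztrace u /\ y = G u.
  by move=> h; have [E [u ->]] := ZtraceP h; exists (G u), E, u.
exists phi; split=> [h|h k hk|E u].
- by have [E [u [_ ->]]] := phiP h; have [+ _ _] := G_FCA E; exact.
- have [E [u [hu ->]]] := phiP h; have [F [v [kv ->]]] := phiP k.
  by apply: Gle => x; move: (hk x); rewrite hu kv.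
- have [F [v [uv ->]]] := phiP (Ztrace u).
  (* [u] and [v] have different domain types, so only their zero extensions to [X] can be
     compared. *)
  have {}uv x : zero_ext (val u) x = zero_ext (val v) x.
    exact: (congr1 (fun h : trace_domain R calE => val h x) uv).
  by apply/le_anti/andP; split; apply: Gle => x; rewrite uv.
Qed.

Section TraceRule.
Context (G_FCA : FCA G) (phi : trace_domain R calE -> \bar R).
Context (phi_rule : trace_rule_functional G phi).

Lemma lower_trace_generator :
  trace_generator calE_measurable G (lower_generator phi).
Proof.
case: phi_rule => phi_ge0 phi_nd phiG; split.
- by move=> f; apply: ereal_sup_ubound; left.
- move=> f g fg; apply: ereal_sup_le => _ [->|[h hf <-]]; first by left.
  by right; exists h => // x; exact: le_trans (hf x) (fg x).
- apply/le_anti/andP; split; last by apply: ereal_sup_ubound; left.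
  (* The set [E] comes from [h] itself: [h] lies below [0_X], the zero extension of [0_E], so
     [phi h] is at most [G_E(0_E) = 0]. *)
  apply: ge_ereal_sup => _ [->//|[h h0 <-]].
  have [E _] := ZtraceP h; have [_ _ <-] := G_FCA E.
  by rewrite -phiG; apply: phi_nd => x; rewrite /= zeroFE_ext; exact: h0.
- move=> E u; apply/le_anti/andP; split.
    by apply: ereal_sup_ubound; right; exists (Ztrace u).
  apply: ge_ereal_sup => _ [->|[h hu <-]]; rewrite -phiG; first exact: phi_ge0.
  exact: phi_nd.
Qed.

(** A nonempty set in [calE] puts [0_X] into the trace domain, with [phi] value 0; this brings the
    infimum at [0_X] down to 0. *)
Lemma upper_trace_generator : nonempty_sets calE !=set0 ->
  trace_generator calE_measurable G (upper_generator phi).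
Proof.
case: phi_rule => phi_ge0 phi_nd phiG [E0 calE_E0].
have upper_ge0 : nonneg_functional (upper_generator phi).
  by move=> f; apply: le_ereal_inf_tmp => _ [h _ <-]; exact: phi_ge0.
split=> //.
- move=> f g fg; apply: ereal_inf_le_tmp => _ [h gh <-].
  by exists h => // x; exact: le_trans (fg x) (gh x).
- pose E : nonempty_sets calE := SigSub (mem_set calE_E0).
  apply/le_anti/andP; split=> //; have [_ _ <-] := G_FCA E.
  apply: ereal_inf_lbound; exists (Ztrace (zeroFE R (val E))); last exact: phiG.
  by move=> x /=; rewrite zeroFE_ext.
- move=> E u; apply/le_anti/andP; split; last first.
    by apply: ereal_inf_lbound; exists (Ztrace u); [|exact: phiG].
  by apply: le_ereal_inf_tmp => _ [h uh <-]; rewrite -phiG; exact: phi_nd.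
Qed.

Lemma lower_generator_le Phi :
  trace_generator calE_measurable G Phi ->
  forall f, (lower_generator phi f <= Phi f)%E.
Proof.
case: phi_rule => _ _ phiG [Phi_ge0 Phi_nd _ PhiG] f.
apply: ge_ereal_sup => _ [->|[h hf <-]]; first exact: Phi_ge0.
have [E [u hu]] := ZtraceP h; move: hf; rewrite hu phiG PhiG => hf.
exact: Phi_nd.
Qed.

Lemma upper_generator_ge Phi :
  trace_generator calE_measurable G Phi ->
  forall f, (Phi f <= upper_generator phi f)%E.
Proof.
case: phi_rule => _ _ phiG [_ Phi_nd _ PhiG] f.
apply: le_ereal_inf_tmp => _ [h fh <-].
have [E [u hu]] := ZtraceP h; move: fh; rewrite hu phiG PhiG => fh.
exact: Phi_nd.
Qed.

End TraceRule.

Lemma one_bF : bF R X (fun=> 1).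
Proof.
split=> //; exists 1; split=> // M M1 x _ /=.
by rewrite normr1 ltW.
Qed.

(* When calE contains no nonempty set, G imposes no condition on a generator,
   so this one and the zero functional show that uniqueness fails. *)
Lemma pinfty_off_zero_trace_generator : ~ (nonempty_sets calE !=set0) ->
  trace_generator calE_measurable G
    (fun f => if `[< f = zeroF R X >] then 0 else +oo)%E.
Proof.
move=> calE0; split=> [f|f g fg||E]; first by case: ifP.
(* If [g] is [0_X], then [0 <= f <= g] forces [f] to be [0_X]; otherwise the bound is [+oo]. *)
- case: (asboolP (g = _)) => [g0|_]; last by rewrite leey.
  rewrite asboolT//; apply: val_inj; apply/funext => x.
  have [_ f0 _] := set_valP f; apply/le_anti.
  by rewrite f0 andbT; apply: le_trans (fg x) _; rewrite g0.
- by rewrite asboolT.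
- by case: calE0; exists (val E); exact: set_valP E.
Qed.

Lemma trace_generator_not_unique : ~ (nonempty_sets calE !=set0) ->
  ~ exists! Phi, trace_generator calE_measurable G Phi.
Proof.
move=> calE0 [Phi [_ Phi_uniq]].
have zero_gen : trace_generator calE_measurable G (fun=> 0%E).
  by split=> // E; case: calE0; exists (val E); exact: set_valP E.
have := Phi_uniq _ (pinfty_off_zero_trace_generator calE0).
(* At the constant function 1 the two generators take the values 0 and [+oo]; that function differs
   from [0_X] at [point]. *)
rewrite (Phi_uniq _ zero_gen) => /(congr1 (@^~ (SigSub (mem_set one_bF)))) /=.
case: asboolP => // /(congr1 (fun f : bF R X => val f point)) /= /eqP.
by rewrite oner_eq0.
Qed.

End TraceGenerators.

(* If calE = {set0} there is no zero extension at all and [upper_generator] is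
   +oo even at 0_X, so it is not a generator; this is the only claim that needs
   calE to contain a nonempty set, and it carries that condition. *)
Theorem theorem4p2 (R : realType) (d : measure_display) (X : measurableType d)
    (calE : set (set X)) (calE_measurable : calE `<=` measurable)
    (calE_nonempty : calE !=set0)
    (G : functional_family R calE) (G_FCA : FCA G) :
  let generator := trace_generator calE_measurable G in
  [/\ (exists Phi, generator Phi) <-> globally_order_compatible G,
      globally_order_compatible G <-> (exists phi, trace_rule_functional G phi)
    & forall phi, trace_rule_functional G phi ->
      [/\ least_functional generator (lower_generator phi),
          nonempty_sets calE !=set0 ->
            greatest_functional generator (upper_generator phi),
          forall Phi, generator Phi -> forall f,
            (lower_generator phi f <= Phi f <= upper_generator phi f)%E
        & (exists! Phi, generator Phi) <->
            lower_generator phi = upper_generator phi]].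
Proof.
move=> generator; split.
- split=> [[Phi]|]; first exact: trace_generator_order_compatible.
  (* The lower generator is the witness because it remains a generator, identically 0, when the
     trace domain is empty. *)
  move=> /(order_compatible_trace_rule G_FCA)[phi phi_rule].
  by exists (lower_generator phi); exact: lower_trace_generator.
- split; first exact: order_compatible_trace_rule.
  by case=> phi; exact: trace_rule_order_compatible.
move=> phi phi_rule.
have low_gen : generator (lower_generator phi) by exact: lower_trace_generator.
have low_le Phi : generator Phi -> forall f, (lower_generator phi f <= Phi f)%E.
  exact: lower_generator_le.
have up_ge Phi : generator Phi -> forall f, (Phi f <= upper_generator phi f)%E.
  exact: upper_generator_ge.
split=> //.
- by move=> calE0; split=> //; exact: upper_trace_generator.
- by move=> Phi genPhi f; rewrite low_le// up_ge.
split=> [Phi_uniq|low_up].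
  (* With a nonempty set in [calE] both extremes are generators, so uniqueness identifies them;
     without one, uniqueness is contradictory. *)
  have [calE0|calE0] := pselect (nonempty_sets calE !=set0).
    case: Phi_uniq => Phi [_ Phi_uniq].
    by rewrite -(Phi_uniq _ low_gen); apply: Phi_uniq; exact: upper_trace_generator.
  by case: (trace_generator_not_unique calE0 Phi_uniq).
(* Any generator is squeezed between the two equal bounds. *)
exists (lower_generator phi); split=> // Phi genPhi.
by apply/funext => f; apply/le_anti; rewrite low_le//= low_up up_ge.
Qed.
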